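(* Let $N\in\mathbb{R}$ and let $x,n,\tilde x,\tilde n\in\mathbb{R}^p$ and $\beta,\tilde\beta\in\mathbb{R}^{p+2}$ be related by $$x_i=\tilde n_1+\cdots+\tilde n_{p+1-i}+\tilde\beta_{p+2-i}-\tilde\beta_0+N-1\quad(1\le i\le p),$$ $$n_1=\tilde x_p+\tilde\beta_p+N,\qquad n_i=\tilde x_{p+1-i}-\tilde x_{p+2-i}+\tilde\beta_{p+1-i}-\tilde\beta_{p+2-i}\quad(2\le i\le p),$$ $$\beta_0=\tilde\beta_0,\qquad \beta_i=\tilde\beta_0-\tilde\beta_{p+2-i}-2N+1\quad(1\le i\le p+1).$$ If $n,\tilde n\in\mathbb{N}_0^p$, then $$\hat R_p(n;x;\beta;N)=\hat R_p(\tilde n;\tilde x;\tilde\beta;N).$$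
   Context: Notation: $p\ge1$, $\beta=(\beta_0,\dots,\beta_{p+1})$, $\tilde\beta=(\tilde\beta_0,\dots,\tilde\beta_{p+1})$, $|n|=n_1+\cdots+n_p$, $N_1^j=n_1+\cdots+n_j$, $N_1^0=0$, $(a)_k=a(a+1)\cdots(a+k-1)$, and $x_{p+1}=N$ (likewise $\tilde x_{p+1}=N$). The one-variable Racah polynomials are $$r_n(\alpha,\beta,\gamma,\delta;x)=(\alpha+1)_n(\beta+\delta+1)_n(\gamma+1)_n\;{}_4F_3\!\left[\begin{matrix}-n,\ n+\alpha+\beta+1,\ -x,\ x+\gamma+\delta+1\\ \alpha+1,\ \beta+\delta+1,\ \gamma+1\end{matrix};1\right],$$ where the denominators of the hypergeometric series are cancelled against the prefactor, i.e. $r_n=\sum_{k=0}^n\frac{(-n)_k(n+\alpha+\beta+1)_k(-x)_k(x+\gamma+\delta+1)_k}{k!}(\alpha+1+k)_{n-k}(\beta+\delta+1+k)_{n-k}(\gamma+1+k)_{n-k}$. For $n\in\mathbb{N}_0^p$ the multivariable Racah polynomials are $$R_p(n;x;\beta;N)=\prod_{k=1}^p r_{n_k}\big(2N_1^{k-1}+\beta_k-\beta_0-1,\ \beta_{k+1}-\beta_k-1,\ N_1^{k-1}-x_{k+1}-1,\ N_1^{k-1}+\beta_k+x_{k+1};\ -N_1^{k-1}+x_k\big),$$ and their normalized version is $$\hat R_p(n;x;\beta;N)=\frac{R_p(n;x;\beta;N)}{(-N)_{|n|}\,(-N-\beta_0)_{|n|}\,\prod_{k=1}^p(\beta_{k+1}-\beta_k)_{n_k}}.$$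 Convention: if $N\in\mathbb{N}_0$ these polynomials are considered only for $|n|\le N$ (so both $|n|\le N$ and $|\tilde n|\le N$ are understood in that case). The parameters are assumed to be such that the denominators in the definitions of $\hat R_p(n;x;\beta;N)$ and $\hat R_p(\tilde n;\tilde x;\tilde\beta;N)$ are nonzero. *)

(* Defs.v *)
From mathcomp Require Import all_boot all_order all_algebra.
From mathcomp Require Import reals.

Set Implicit Arguments.
Unset Strict Implicit.
Unset Printing Implicit Defensive.

Import GRing.Theory Num.Theory.
Local Open Scope ring_scope.

(* v_i for vectors numbered from 1 (only meaningful for 1 <= i <= size v).
   The parameter vectors beta = (beta_0, ..., beta_{p+1}) are numbered from 0
   and are accessed with the usual beta`_i instead. *)
Definition nth1 (V : nmodType) (v : seq V) (i : nat) : V := nth 0 v i.-1.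

(* v_1 + ... + v_j; the total degree |n| is psum n p. *)
Definition psum (v : seq nat) (j : nat) : nat :=
  (\sum_(1 <= i < j.+1) nth1 v i)%N.

Definition poch (R : pzRingType) (a : R) (k : nat) : R :=
  \prod_(i < k) (a + i%:R).

(* The prefactor (a+1)_n (b+d+1)_n (c+1)_n times the terminating 4F3 series at 1
   with its denominators cancelled, using (u)_n = (u)_k (u+k)_{n-k}; it is thus
   defined for all parameters. *)
Definition racah (R : fieldType) (n : nat) (a b c d x : R) : R :=
  \sum_(k < n.+1)
    poch (- n%:R) k * poch (n%:R + a + b + 1) k
      * poch (- x) k * poch (x + c + d + 1) k / k`!%:R
    * poch (a + 1 + k%:R) (n - k)
    * poch (b + d + 1 + k%:R) (n - k)
    * poch (c + 1 + k%:R) (n - k).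

(* [rcons x N] implements the convention x_{p+1} = N. *)
Definition mracah (R : fieldType) (p : nat) (n : p.-tuple nat)
    (x : p.-tuple R) (beta : p.+2.-tuple R) (N : R) : R :=
  \prod_(1 <= k < p.+1)
    let S : R := (psum n k.-1)%:R in
    let xk := nth1 (rcons x N) k in
    let xk1 := nth1 (rcons x N) k.+1 in
    racah (nth1 n k)
      (2%:R * S + beta`_k - beta`_0 - 1)
      (beta`_k.+1 - beta`_k - 1)
      (S - xk1 - 1)
      (S + beta`_k + xk1)
      (- S + xk).

Definition mracah_den (R : fieldType) (p : nat) (n : p.-tuple nat)
    (beta : p.+2.-tuple R) (N : R) : R :=
  poch (- N) (psum n p) * poch (- N - beta`_0) (psum n p)
    * \prod_(1 <= k < p.+1) poch (beta`_k.+1 - beta`_k) (nth1 n k).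

Definition mracah_hat (R : fieldType) (p : nat) (n : p.-tuple nat)
    (x : p.-tuple R) (beta : p.+2.-tuple R) (N : R) : R :=
  mracah n x beta N / mracah_den n beta N.

(* Main.v *)
Require Import Defs.
From mathcomp Require Import all_boot all_order all_algebra.
From mathcomp Require Import reals.
From mathcomp Require Import ring.

Set Implicit Arguments.
Unset Strict Implicit.
Unset Printing Implicit Defensive.

Import GRing.Theory Num.Theory.
Local Open Scope ring_scope.

(** The duality matches the k-th factor of R_p(n; x; beta) with the
    (p+1-k)-th factor of R_p(nt; xt; betat), and it is proved factor by factor.

    Write S_k = n_1 + ... + n_k and T_j = nt_1 + ... + nt_j. The change of
    variables takes the form of a symmetric system, for 1 <= k <= p:
      x_k + beta_k + N = T_(p+1-k),     xt_k + betat_k + N = S_(p+1-k),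
    together with beta_k + betat_(p+2-k) = beta_0 - 2 N + 1 for
    1 <= k <= p+1. Each one-variable factor is a terminating balanced 4F3, and
    Whipple's transformation (lemma [whipple], deduced from the
    Pfaff-Saalschuetz sum [saalschutz]) turns the factor of degree n_k into a
    4F3 having both -n_k and -nt_(p+1-k) among its numerator parameters
    ([racah_dual_factor]). The same transformation applied to the matching dual
    factor gives the same 4F3 series, so that, up to Pochhammer prefactors, the
    two factors agree ([cleared4F3_dual]).

    It remains to compare prefactors. Put v_k = S_k + T_(p-k) and
    phi(v) = (-N)_v (-N - beta_0)_v. For k-th factors F_k and Ft_k so matched,
    and with e_k = beta_(k+1) - beta_k,
      F_k (e_k)_(nt_(p+1-k)) phi(v_(k-1)) = Ft_k (e_k)_(n_k) phi(v_k),
    which is [dual_factor_step]. Multiplying over k, the phi's telescope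
    ([prod_telescope]) and leave phi(v_0) = phi(T_p) and phi(v_p) = phi(S_p),
    which together with the products of the (e_k) are the two normalizations.
    The intermediate phi(v_k) may well vanish, for instance when N is a
    natural number smaller than v_k; for this reason the telescoping is done on
    products and never divides by them. *)

(** * Rising factorials and finite sums *)

Lemma poch0 (R : pzRingType) (a : R) : poch a 0 = 1.
Proof. exact: big_ord0. Qed.

Lemma pochSr (R : pzRingType) (a : R) (k : nat) :
  poch a k.+1 = poch a k * (a + k%:R).
Proof. exact: big_ord_recr. Qed.

Lemma pochD (R : comPzRingType) (a : R) (m k : nat) :
  poch a (m + k) = poch a m * poch (a + m%:R) k.
Proof.
elim: k => [|k IHk]; first by rewrite addn0 poch0 mulr1.
by rewrite addnS !pochSr IHk natrD addrA mulrA.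
Qed.

Lemma pochS (R : comPzRingType) (a : R) (k : nat) :
  poch a k.+1 = a * poch (a + 1) k.
Proof. by rewrite -add1n pochD pochSr poch0 mul1r addr0. Qed.

Lemma poch_reflect (R : comNzRingType) (a : R) (k : nat) :
  poch (1 - k%:R - a) k = (-1) ^+ k * poch a k.
Proof.
elim: k a => [|k IHk] a; first by rewrite !poch0 mulr1.
rewrite pochSr pochS -[X in poch X k](_ : 1 - k%:R - (a + 1) = _); last first.
  by rewrite -natr1; ring.
by rewrite IHk exprS -natr1; ring.
Qed.

Lemma poch_oppn (R : comNzRingType) (n k : nat) :
  poch (- n%:R) k = (-1) ^+ k * ('C(n, k) * k`!)%:R :> R.
Proof.
rewrite bin_ffact; elim: k => [|k IHk]; first by rewrite poch0 mulr1.
rewrite pochSr IHk ffactnSr exprS natrM.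
have [le_kn | lt_nk] := leqP k n; first by rewrite natrB //; ring.
by rewrite ffact_small // !(mul0r, mulr0).
Qed.

Lemma sum_bin_pascal (R : pzSemiRingType) (k : nat) (F : nat -> R) :
  \sum_(j < k.+2) 'C(k.+1, j)%:R * F j
    = \sum_(j < k.+1) 'C(k, j)%:R * (F j + F j.+1).
Proof.
under [RHS]eq_bigr => j _ do rewrite mulrDr.
rewrite big_split /= big_ord_recl [X in _ = X + _]big_ord_recl /= !bin0.
under eq_bigr => j _ do rewrite /bump /= add1n binS natrD mulrDl.
rewrite big_split /= addrA; congr (_ + _).
by rewrite big_ord_recr /= bin_small // mul0r addr0.
Qed.

(** * The Pfaff-Saalschuetz sum and Whipple's transformation *)

(** The Pfaff-Saalschuetz sum with its denominators cleared. Passing from k to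
    k+1 multiplies the right-hand side by (C - A + k) (C - B + k); the sum for
    k+1 minus this multiple of the sum for k telescopes, by a certificate in the
    style of Wilf and Zeilberger, [G] in the proof. *)
Lemma saalschutz (R : comNzRingType) (k : nat) (A B C : R) :
  \sum_(j < k.+1) 'C(k, j)%:R * (poch A j * poch B j
      * (poch (C + j%:R) (k - j) * poch (C - A - B) (k - j)))
    = poch (C - A) k * poch (C - B) k.
Proof.
elim: k => [|k IHk].
  by rewrite big_ord_recr big_ord0 /= !poch0 bin0 !mulr1 add0r.
pose F j := poch A j * poch B j
  * (poch (C + j%:R) (k.+1 - j) * poch (C - A - B) (k.+1 - j)).
rewrite (sum_bin_pascal k F) !pochSr mulrACA -IHk mulr_suml.
apply/eqP; rewrite -subr_eq0 -sumrB; apply/eqP.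
(* The factor j makes G 0 vanish, the binomial makes G k.+1 vanish. *)
pose G j := j%:R * 'C(k, j)%:R
  * (poch A j * poch B j
     * (poch (C + j%:R) (k - j) * poch (C - A - B) (k.+1 - j))).
rewrite -(big_mkord xpredT (fun j => 'C(k, j)%:R * (F j + F j.+1)
  - 'C(k, j)%:R * (poch A j * poch B j
      * (poch (C + j%:R) (k - j) * poch (C - A - B) (k - j)))
    * ((C - A + k%:R) * (C - B + k%:R)))).
transitivity (G k.+1 - G 0); last first.
  by rewrite /G bin_small // !(mul0r, mulr0) subr0.
rewrite -(telescope_sumr G (leq0n k.+1)).
apply: eq_big_nat => j; rewrite ltnS => /= le_jk.
have binE : j.+1%:R * 'C(k, j.+1)%:R = (k%:R - j%:R) * 'C(k, j)%:R :> R.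
  by rewrite -natrB // -!natrM mul_bin_left.
rewrite /G binE /F subSn // subSS !pochSr.
have [m ->] : exists m, k = (j + m)%N by exists (k - j)%N; rewrite subnKC.
(* For j = k the polynomial (C + j + 1)_(k - j - 1), common to all terms
   otherwise, is not defined. *)
rewrite addKn natrD; case: m => [|m]; first by rewrite !poch0; ring.
rewrite subnS addKn /= [poch (C + j%:R) _]pochS !pochSr.
by rewrite -[j.+1%:R]natr1 -[m.+1%:R]natr1 (addrA C); ring.
Qed.

(** The same sum with the fourth parameter C - A - B traded, by reflection, for
    the second denominator parameter F fixed by the balancing condition. This
    is the shape in which the inner sum of [whipple] appears. *)
Lemma saalschutz_alt (R : comNzRingType) (M : nat) (a s E F : R) :
  E + F = a + s + 1 - M%:R ->
  \sum_(m < M.+1) (-1) ^+ m * 'C(M, m)%:R * (poch a m * poch s m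
      * (poch (E + m%:R) (M - m) * poch (F + m%:R) (M - m)))
    = poch (a + 1 - M%:R - E) M * poch (a + 1 - M%:R - F) M.
Proof.
move=> EF; have -> : a + 1 - M%:R - E = 1 - M%:R - (E - a) by ring.
have -> : a + 1 - M%:R - F = E - s by rewrite -(addKr E F) EF; ring.
rewrite poch_reflect -mulrA -saalschutz mulr_sumr.
apply: eq_bigr => m _; have le_mM : (m <= M)%N by rewrite -ltnS.
have -> : F + m%:R = 1 - (M - m)%:R - (E - a - s).
  by rewrite natrB // -(addKr E F) EF; ring.
have -> : (-1) ^+ M = (-1) ^+ m * (-1) ^+ (M - m) :> R.
  by rewrite -exprD subnKC.
by rewrite poch_reflect; ring.
Qed.

Lemma bin_trinomial (n j k : nat) : (j <= k <= n)%N ->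
  ('C(n, j) * 'C(n - j, k - j) = 'C(n, k) * 'C(k, j))%N.
Proof.
case/andP=> le_jk le_kn; have le_jn := leq_trans le_jk le_kn.
have kj_nj : (k - j <= n - j)%N by apply: leq_sub2r.
apply/eqP; rewrite -(eqn_pmul2r (fact_gt0 j)) -(eqn_pmul2r (fact_gt0 (k - j))).
rewrite -(eqn_pmul2r (fact_gt0 (n - k))); apply/eqP.
transitivity n`!.
  rewrite -(bin_fact le_jn) -(bin_fact kj_nj) subnBA // subnK //; ring.
by rewrite -(bin_fact le_kn) -(bin_fact le_jk); ring.
Qed.

Lemma sum_triangle (R : nmodType) (n : nat) (F : nat -> nat -> R) :
  \sum_(k < n.+1) \sum_(j < k.+1) F j (k - j)%N
    = \sum_(j < n.+1) \sum_(m < (n - j).+1) F j m.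
Proof.
elim: n => [|n IHn]; first by rewrite !big_ord1.
rewrite big_ord_recr IHn [RHS]big_ord_recr /= subnn big_ord1.
rewrite [X in _ + X = _]big_ord_recr /= subnn addrA -big_split /=; congr (_ + _).
apply: eq_bigr => j _; rewrite [in RHS]subSn -1?ltnS // [RHS]big_ord_recr /=.
by rewrite -subSn // -ltnS.
Qed.

(** The polynomial (d)_n (e)_n (f)_n 4F3(-n, a, b, c; d, e, f; 1): the
    denominators are cancelled by (u)_n = (u)_k (u + k)_(n - k), and
    (-n)_k / k! is (-1)^k times a binomial coefficient, so that no division is
    left. *)
Definition cleared4F3 (R : pzRingType) (n : nat) (a b c d e f : R) : R :=
  \sum_(k < n.+1) (-1) ^+ k * 'C(n, k)%:R * (poch a k * poch b k * poch c k)
    * (poch (d + k%:R) (n - k) * poch (e + k%:R) (n - k)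
       * poch (f + k%:R) (n - k)).

(** Whipple's transformation of a balanced terminating 4F3. Expand (b)_k (c)_k
    by Pfaff-Saalschuetz as a sum over j of terms in (d - b)_j (d - c)_j, and
    exchange the summations: the sum over k is then again a Saalschuetz sum. *)
Lemma whipple (R : comNzRingType) (n : nat) (a b c d e f : R) :
  d + e + f = a + b + c + 1 - n%:R ->
  cleared4F3 n a b c d e f
    = cleared4F3 n a (d - b) (d - c) d (a + 1 - n%:R - e) (a + 1 - n%:R - f).
Proof.
move=> bal.
(* T j m is the term of the double sum with k = j + m. *)
pose T j m := (-1) ^+ (j + m) * ('C(n, j) * 'C(n - j, m))%:R
  * (poch a (j + m) * poch (d - b) j * poch (d - c) j * poch (d + j%:R) (n - j))
  * (poch (b + c - d) m * poch (e + (j + m)%:R) (n - j - m)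
     * poch (f + (j + m)%:R) (n - j - m)).
transitivity (\sum_(k < n.+1) \sum_(j < k.+1) T j (k - j)%N).
  apply: eq_bigr => k _; have le_kn : (k <= n)%N by rewrite -ltnS.
  have -> : poch a k * poch b k * poch c k
      = poch a k * \sum_(j < k.+1) 'C(k, j)%:R * (poch (d - b) j * poch (d - c) j
          * (poch (d + j%:R) (k - j) * poch (d - (d - b) - (d - c)) (k - j))).
    by rewrite saalschutz -mulrA; congr (_ * (poch _ _ * poch _ _)); ring.
  rewrite mulr_sumr mulr_sumr mulr_suml; apply: eq_bigr => j _.
  have le_jk : (j <= k)%N by rewrite -ltnS.
  rewrite /T subnKC //.
  have -> : ('C(n, j) * 'C(n - j, k - j) = 'C(n, k) * 'C(k, j))%N.
    by rewrite bin_trinomial // le_jk.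
  have njE : (n - j = (k - j) + (n - k))%N by rewrite addnC addnBA // subnK.
  have -> : (n - j - (k - j) = n - k)%N by rewrite njE addKn.
  have -> : poch (d + j%:R) (n - j)
      = poch (d + j%:R) (k - j) * poch (d + k%:R) (n - k).
    by rewrite njE pochD -[_ + _ + _]addrA -natrD subnKC.
  rewrite natrM.
  have -> : d - (d - b) - (d - c) = b + c - d by ring.
  ring.
rewrite sum_triangle; apply: eq_bigr => j _.
have le_jn : (j <= n)%N by rewrite -ltnS.
pose M := (n - j)%N.
have nE : n%:R = j%:R + M%:R :> R by rewrite -natrD subnKC.
have inner := @saalschutz_alt R M (a + j%:R) (b + c - d) (e + j%:R) (f + j%:R).
have eE : a + j%:R + 1 - M%:R - (e + j%:R) = a + 1 - n%:R - e + j%:R.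
  by rewrite nE; ring.
have fE : a + j%:R + 1 - M%:R - (f + j%:R) = a + 1 - n%:R - f + j%:R.
  by rewrite nE; ring.
rewrite eE fE in inner.
rewrite -/M -(mulrA (poch (d + j%:R) M)) -inner; last first.
  have -> : e + j%:R + (f + j%:R) = d + e + f - d + j%:R + j%:R by ring.
  by rewrite bal nE; ring.
rewrite !mulr_sumr; apply: eq_bigr => m _.
rewrite /T -/M pochD exprD natrD natrM !addrA; ring.
Qed.

(** * The symmetric form of a one-variable factor *)

(** The denominator parameter beta + delta + 1 comes first because it is the
    one around which [whipple] will be applied. *)
Lemma racah_cleared4F3 (R : numFieldType) (n : nat) (a b c d x : R) :
  racah n a b c d x
    = cleared4F3 n (n%:R + a + b + 1) (x + c + d + 1) (- x)
        (b + d + 1) (a + 1) (c + 1).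
Proof.
apply: eq_bigr => k _; rewrite poch_oppn natrM.
have /eqP k0 : k`!%:R != 0 :> R by rewrite pnatr_eq0 -lt0n fact_gt0.
by field; apply/eqP.
Qed.

Lemma cleared4F3_swap (R : comNzRingType) (n : nat) (a b c d e f : R) :
  cleared4F3 n a b c d e f = cleared4F3 n a b c f e d.
Proof. by apply: eq_bigr => k _; ring. Qed.

(** The extra terms vanish with their binomials; two sums of different degrees
    can thus be compared termwise. *)
Lemma cleared4F3_widen (R : comNzRingType) (n M : nat) (a b c d e f : R) :
  (n <= M)%N ->
  cleared4F3 n a b c d e f
    = \sum_(k < M.+1) (-1) ^+ k * 'C(n, k)%:R * (poch a k * poch b k * poch c k)
    * (poch (d + k%:R) (n - k) * poch (e + k%:R) (n - k)
       * poch (f + k%:R) (n - k)).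
Proof.
move=> le_nM; rewrite /cleared4F3.
rewrite [LHS](big_ord_widen M.+1 (fun k => (-1) ^+ k * 'C(n, k)%:R
   * (poch a k * poch b k * poch c k) * (poch (d + k%:R) (n - k)
   * poch (e + k%:R) (n - k) * poch (f + k%:R) (n - k)))) // [LHS]big_mkcond.
apply: eq_bigr => k _; case: ifPn => //; rewrite -leqNgt => lt_nk.
by rewrite bin_small // !(mulr0, mul0r).
Qed.

Lemma poch_exchange (R : comPzRingType) (a : R) (k n t : nat) :
  (k <= n)%N -> (k <= t)%N ->
  poch (a + k%:R) (n - k) * poch a t = poch (a + k%:R) (t - k) * poch a n.
Proof.
move=> le_kn le_kt.
have pochE m : (k <= m)%N -> poch a m = poch a k * poch (a + k%:R) (m - k).
  by move=> le_km; rewrite -pochD subnKC.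
by rewrite (pochE t) // (pochE n) // mulrCA [RHS]mulrCA [X in _ * X = _]mulrC.
Qed.

(** With -t among the numerator parameters, n and t play the same role in the
    uncleared series; the two sides differ only by the parameters of the
    prefactor that clears denominators. For k <= n and k <= t both sides have
    k-th coefficient k! C(n, k) C(t, k), and the other terms vanish. *)
Lemma cleared4F3_dual (R : comNzRingType) (n t : nat) (a c d e f : R) :
  cleared4F3 n a (- t%:R) c d e f * (poch d t * poch e t * poch f t)
    = cleared4F3 t c (- n%:R) a d e f * (poch d n * poch e n * poch f n).
Proof.
rewrite (cleared4F3_widen _ _ _ _ _ _ (leq_addr t n)).
rewrite (cleared4F3_widen _ _ _ _ _ _ (leq_addl n t)).
rewrite !mulr_suml; apply: eq_bigr => k _; rewrite !poch_oppn !natrM.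
have [lt_nk | le_kn] := ltnP n k.
  by rewrite (bin_small lt_nk) !(mulr0, mul0r).
have [lt_tk | le_kt] := ltnP t k.
  by rewrite (bin_small lt_tk) !(mulr0, mul0r).
set s := (-1) ^+ k; set L := LHS.
have -> : L = s * 'C(n, k)%:R
    * (poch a k * (s * ('C(t, k)%:R * k`!%:R)) * poch c k)
    * ((poch (d + k%:R) (n - k) * poch d t) * (poch (e + k%:R) (n - k) * poch e t)
       * (poch (f + k%:R) (n - k) * poch f t)) by rewrite /L; ring.
rewrite !(@poch_exchange _ _ k n t) //; ring.
Qed.

(** The Whipple transform of the factor of degree n, where S and T are the
    partial degrees preceding n and t, B and B' two consecutive beta's, and g is
    beta_0. Exchanging (n, S) with (t, T) and replacing B, B' by
    g - 2 N + 1 - B', g - 2 N + 1 - B exchanges n with t and the other two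
    numerator parameters with each other, and fixes the denominator
    parameters. *)
Definition dual_factor (R : pzRingType) (n t : nat) (S T B B' g N : R) : R :=
  cleared4F3 n (2%:R * S + n%:R + B' - g - 1) (- t%:R)
    (2%:R * T + t%:R - B - 2%:R * N) (S + T - N) (B' - B) (S + T - N - g).

(** The factor depends on X = x_(k+1) only through the unordered pair X and
    - X - B'. This absorbs the boundary case k = p, where x_(p+1) = N does not
    follow the pattern X + B' + N = T of the other variables but its mirror
    image - X - B' does, with T = 0. *)
Lemma racah_dual_factor (R : numFieldType) (n t : nat)
    (S T B B' g N x X : R) :
  x + B + N = T + t%:R -> X + B' + N = T \/ X = N - T ->
  racah n (2%:R * S + B - g - 1) (B' - B - 1) (S - X - 1) (S + B + X) (- S + x)
    = dual_factor n t S T B B' g N.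
Proof.
move=> hx hX; have -> : x = T + t%:R - B - N by rewrite -hx; ring.
transitivity (cleared4F3 n (2%:R * S + n%:R + B' - g - 1)
    (S + T + t%:R - N) (S - T - t%:R + B + N)
    (S + T - N) (2%:R * S + B - g) (S - T + B' + N)).
  rewrite racah_cleared4F3; case: hX => [hX | ->]; last rewrite cleared4F3_swap.
    have -> : X = T - B' - N by rewrite -hX; ring.
    by congr (cleared4F3 _ _ _ _ _ _ _); ring.
  by congr (cleared4F3 _ _ _ _ _ _ _); ring.
rewrite whipple; last by ring.
by rewrite /dual_factor; congr (cleared4F3 _ _ _ _ _ _ _); ring.
Qed.

(** * Assembling the factors *)

Lemma mracah_dual_factors (R : numFieldType) (p : nat) (n nt : p.-tuple nat)
    (x : p.-tuple R) (beta : p.+2.-tuple R) (N : R) :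
  (forall k, (1 <= k <= p)%N ->
     nth1 x k + beta`_k + N = (psum nt (p.+1 - k))%:R) ->
  mracah n x beta N = \prod_(1 <= k < p.+1)
    dual_factor (nth1 n k) (nth1 nt (p.+1 - k)) (psum n k.-1)%:R
      (psum nt (p - k))%:R beta`_k beta`_k.+1 beta`_0 N.
Proof.
move=> hx; apply: eq_big_nat => k; rewrite ltnS => /andP[k_gt0 le_kp].
have lt_kp : (k.-1 < p)%N by rewrite prednK.
apply: racah_dual_factor.
  rewrite /nth1 nth_rcons size_tuple lt_kp -/(nth1 x k) hx ?k_gt0 // subSn //.
  by rewrite /psum big_nat_recr //= natrD.
rewrite /nth1 nth_rcons size_tuple /=; case: ltngtP le_kp => // [lt_k _ | -> _].
  by left; rewrite -/(nth1 x k.+1) hx // subSS.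
by right; rewrite subnn /psum big_geq // subr0.
Qed.

(** Telescoping of the ratios phi k / phi k.-1 = h k / h' k, kept in product
    form because phi may vanish at intermediate indices. *)
Lemma prod_telescope (R : comPzRingType) (p : nat) (phi h h' : nat -> R) :
  (forall k, (1 <= k <= p)%N -> h k * phi k.-1 = h' k * phi k) ->
  phi 0 * \prod_(1 <= k < p.+1) h k = phi p * \prod_(1 <= k < p.+1) h' k.
Proof.
elim: p => [|p IHp] step; first by rewrite !big_geq.
rewrite big_nat_recr // [in RHS]big_nat_recr //= mulrA IHp; last first.
  by move=> k /andP[k_gt0 le_kp]; rewrite step // k_gt0 leqW.
have := step p.+1; rewrite leqnn => /(_ isT) /= stepE.
by rewrite mulrAC (mulrC (phi p)) stepE (mulrC (h' _)) -mulrA (mulrC (h' _)).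
Qed.

(** Since phi (S + T + m) = phi (S + T) (d)_m (d - g)_m with d = S + T - N, the
    prefactors left over by [cleared4F3_dual] are values of phi, up to those of
    the middle denominator parameter B' - B = b' - b. *)
Lemma dual_factor_step (R : comNzRingType) (n t S T : nat)
    (B B' b b' g N : R) :
  B + b' = g - 2%:R * N + 1 -> B' + b = g - 2%:R * N + 1 ->
  let phi v := poch (- N) v * poch (- N - g) v in
  dual_factor n t S%:R T%:R B B' g N * poch (b' - b) t * phi (S + (T + t))%N
    = dual_factor t n T%:R S%:R b b' g N * poch (B' - B) n * phi (S + n + T)%N.
Proof.
move=> hB hB' phi.
have -> : B = g - 2%:R * N + 1 - b' by rewrite -hB; ring.
have -> : B' = g - 2%:R * N + 1 - b by rewrite -hB'; ring.
have phiD m : phi (S + T + m)%N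
    = phi (S + T)%N * (poch (S%:R + T%:R - N) m * poch (S%:R + T%:R - N - g) m).
  rewrite /phi !pochD -natrD.
  have -> : - N + (S + T)%:R = (S + T)%:R - N by ring.
  have -> : - N - g + (S + T)%:R = (S + T)%:R - N - g by ring.
  ring.
rewrite addnA (addnAC S n T) !phiD.
set d := S%:R + T%:R - N; set e := b' - b.
have := cleared4F3_dual n t (2%:R * S%:R + n%:R - b - 2%:R * N)
  (2%:R * T%:R + t%:R + b' - g - 1) d e (d - g).
rewrite /dual_factor -/d (addrC T%:R) -/d -/e.
have -> : g - 2%:R * N + 1 - b - (g - 2%:R * N + 1 - b') = e by rewrite /e; ring.
have -> : 2%:R * S%:R + n%:R + (g - 2%:R * N + 1 - b) - g - 1
    = 2%:R * S%:R + n%:R - b - 2%:R * N by ring.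
have -> : 2%:R * T%:R + t%:R - (g - 2%:R * N + 1 - b') - 2%:R * N
    = 2%:R * T%:R + t%:R + b' - g - 1 by ring.
move=> dualE; set P := phi _.
set H := cleared4F3 n _ _ _ _ _ _ in dualE *.
set H' := cleared4F3 t _ _ _ _ _ _ in dualE *.
transitivity (P * (H * (poch d t * poch e t * poch (d - g) t))); first by ring.
by rewrite dualE; ring.
Qed.

Theorem theorem4p4 (R : realType) (p : nat) (hp : (1 <= p)%N) (N : R)
  (n nt : p.-tuple nat) (x xt : p.-tuple R) (beta betat : p.+2.-tuple R)
  (hx : forall i : nat, (1 <= i <= p)%N ->
     nth1 x i = (psum nt (p.+1 - i))%:R + betat`_(p.+2 - i) - betat`_0 + N - 1)
  (hn1 : (nth1 n 1)%:R = nth1 xt p + betat`_p + N)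
  (hn : forall i : nat, (2 <= i <= p)%N ->
     (nth1 n i)%:R = nth1 xt (p.+1 - i) - nth1 xt (p.+2 - i)
                     + betat`_(p.+1 - i) - betat`_(p.+2 - i))
  (hbeta0 : beta`_0 = betat`_0)
  (hbeta : forall i : nat, (1 <= i <= p.+1)%N ->
     beta`_i = betat`_0 - betat`_(p.+2 - i) - 2%:R * N + 1)
  (hN : forall M : nat, N = M%:R -> (psum n p <= M)%N /\ (psum nt p <= M)%N)
  (hden : mracah_den n beta N != 0)
  (hdent : mracah_den nt betat N != 0) :
  mracah_hat n x beta N = mracah_hat nt xt betat N.
Proof.
have xE k : (1 <= k <= p)%N ->
    nth1 x k + beta`_k + N = (psum nt (p.+1 - k))%:R.
  move=> /andP[k_gt0 le_kp]; rewrite hx ?k_gt0 // hbeta ?k_gt0 ?leqW //; ring.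
have psumnE k : (1 <= k <= p)%N ->
    (psum n k)%:R = nth1 xt (p.+1 - k) + betat`_(p.+1 - k) + N.
  elim: k => [//|[_ _|k IHk le_kp]].
    by rewrite /psum big_nat1 hn1 subSS subn0.
  rewrite /psum big_nat_recr //= natrD -/(psum n k.+1) IHk ?(ltnW le_kp) //.
  by rewrite hn // !subSS; ring.
have xtE k : (1 <= k <= p)%N ->
    nth1 xt k + betat`_k + N = (psum n (p.+1 - k))%:R.
  move=> /andP[k_gt0 le_kp]; rewrite psumnE; first by rewrite subKn // leqW.
  by rewrite subn_gt0 ltnS le_kp leq_subLR -add1n leq_add2r.
(* Clear the two denominators and number the dual factors backwards, so that
   matching factors have the same index. *)
apply/eqP; rewrite eqr_div //; apply/eqP.
rewrite (mracah_dual_factors n xE) (mracah_dual_factors nt xtE) /mracah_den.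
rewrite [\prod_(_ <= k < _) dual_factor (nth1 nt k) _ _ _ _ _ _ _]big_nat_rev.
rewrite [\prod_(_ <= k < _) poch (betat`_k.+1 - _) _]big_nat_rev hbeta0.
pose phi v := poch (- N) v * poch (- N - betat`_0) v.
rewrite -!/(phi _) [LHS]mulrCA [RHS]mulrCA -!big_split /=.
have psum0 (v : seq nat) : psum v 0 = 0 by rewrite /psum big_geq.
pose Phi k := phi (psum n k + psum nt (p - k))%N.
have -> : phi (psum nt p) = Phi 0 by rewrite /Phi psum0 add0n subn0.
have -> : phi (psum n p) = Phi p by rewrite /Phi subnn psum0 addn0.
apply: prod_telescope => -[//|i] /= lt_ip.
rewrite add1n !subSS /Phi.
have psumS (v : seq nat) j : psum v j.+1 = (psum v j + nth1 v j.+1)%N.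
  by rewrite /psum big_nat_recr.
set T := psum nt (p - i.+1).
have -> : (p.+1 - (p - i) = i.+1)%N by rewrite subSn ?leq_subr // subKn // ltnW.
rewrite (subKn (ltnW lt_ip)) -(subnSK lt_ip) !psumS -/T /=.
apply: (@dual_factor_step R _ _ (psum n i) T); last first.
  rewrite hbeta; last exact: lt_ip.
  by rewrite !subSS -(subnSK lt_ip); ring.
rewrite hbeta; last exact: leqW lt_ip.
by rewrite !subSS (subSn (ltnW lt_ip)) -(subnSK lt_ip); ring.
Qed.
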